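(* Let $A$ and $B$ be Morita equivalent algebras over a field $\Bbbk$, with Morita data $({}_AP_B,{}_BQ_A,\langle-,-\rangle_A,\langle-,-\rangle_B)$ and fixed decompositions $1_B=\sum_{i=1}^{m}\langle q_i,p_i\rangle_B$ and $1_A=\sum_{j=1}^{m'}\langle p'_j,q'_j\rangle_A$ as in the context. For $n\ge 0$ let $\phi^n:\operatorname{Hom}_\Bbbk(A^{\otimes n},A)\to\operatorname{Hom}_\Bbbk(B^{\otimes n},B)$ and $\psi^n:\operatorname{Hom}_\Bbbk(B^{\otimes n},B)\to\operatorname{Hom}_\Bbbk(A^{\otimes n},A)$ be the transfer maps $$\phi^n(f)(b_1\otimes\cdots\otimes b_n)=\sum_{1\le i_0,\dots,i_n\le m}\langle q_{i_0},f(\langle p_{i_0},b_1q_{i_1}\rangle_A\otimes\cdots\otimes\langle p_{i_{n-1}},b_nq_{i_n}\rangle_A)\,p_{i_n}\rangle_B,$$ $$\psi^n(g)(a_1\otimes\cdots\otimes a_n)=\sum_{1\le j_0,\dots,j_n\le m'}\langle p'_{j_0},g(\langle q'_{j_0},a_1p'_{j_1}\rangle_B\otimes\cdots\otimes\langle q'_{j_{n-1}},a_np'_{j_n}\rangle_B)\,q'_{j_n}\rangle_A .$$ Then, for every $n\ge 0$, the induced maps in Hochschild cohomology $$\widetilde{\phi^n}:\mathsf{HH}^n(A)\to\mathsf{HH}^n(B),\quad [f]\mapsto[\phi^n(f)],\qquad \widetilde{\psi^n}:\mathsf{HH}^n(B)\to\mathsf{HH}^n(A),\quad [g]\mapsto[\psi^n(g)],$$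 are isomorphisms and inverse to each other.
   Context: Algebras are associative and unital over a field $\Bbbk$; $\otimes$ means $\otimes_\Bbbk$ unless a subscript is given. Morita data: $A$ and $B$ are Morita equivalent, i.e. there are bimodules ${}_AP_B$, ${}_BQ_A$ and bimodule isomorphisms $\langle-,-\rangle_A:P\otimes_BQ\to A$ and $\langle-,-\rangle_B:Q\otimes_AP\to B$, chosen so that for all $p,p'\in P$, $q,q'\in Q$: $\langle p,q\rangle_A\,p'=p\,\langle q,p'\rangle_B$ and $\langle q,p\rangle_B\,q'=q\,\langle p,q'\rangle_A$. One fixes elements $p'_j,p_k\in P$ and $q'_j,q_k\in Q$ with $1_A=\sum_{j=1}^{m'}\langle p'_j,q'_j\rangle_A$ and $1_B=\sum_{k=1}^{m}\langle q_k,p_k\rangle_B$. Hochschild cohomology: $\mathsf{HH}^n(A)$ is the $n$-th cohomology of the complex $A\xrightarrow{d^1}\operatorname{Hom}_\Bbbk(A,A)\xrightarrow{d^2}\operatorname{Hom}_\Bbbk(A^{\otimes2},A)\to\cdots$, where $d^1(x)(a)=ax-xa$ and $d^{n+1}(f)(a_0\otimes\cdots\otimes a_n)=a_0f(a_1\otimes\cdots\otimes a_n)+\sum_{j=1}^n(-1)^jf(a_0\otimes\cdots\otimes a_{j-1}a_j\otimes\cdots\otimes a_n)+(-1)^{n+1}f(a_0\otimes\cdots\otimes a_{n-1})a_n$. For $f\in\ker d^{n+1}$, $[f]$ denotes its class in $\mathsf{HH}^n(A)$. For $n=0$ the transfer formulas read $\phi^0(a)=\sum_i\langle q_i,a p_i\rangle_B$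 and $\psi^0(b)=\sum_j\langle p'_j,bq'_j\rangle_A$. *)

(* Defs.v *)
From HB Require Import structures.
From mathcomp.multinomials Require Import freeg.
From mathcomp Require Import all_boot all_order all_algebra generic_quotient.
From mathcomp Require Import ring_quotient boolp zify.

Set Implicit Arguments.
Unset Strict Implicit.
Unset Printing Implicit Defensive.

Import GRing.Theory.
Local Open Scope ring_scope.
Local Open Scope quotient_scope.

(* Same content as algType k, except that the zero algebra is allowed. *)
Record algebra (k : fieldType) := Algebra {
  alg_ring : pzRingType;
  alg_scale : k -> alg_ring -> alg_ring;
  alg_scaleA : forall a b x, alg_scale a (alg_scale b x) = alg_scale (a * b) x;
  alg_scale1 : left_id 1 alg_scale;
  alg_scaleDr : right_distributive alg_scale +%R;
  alg_scaleDl : forall x, {morph alg_scale^~ x : a b / a + b};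
  alg_scaleAl : forall a x y, alg_scale a (x * y) = alg_scale a x * y;
  alg_scaleAr : forall a x y, alg_scale a (x * y) = x * alg_scale a y
}.

Definition alg_car (k : fieldType) (A : algebra k) : Type := alg_ring A.
Coercion alg_car : algebra >-> Sortclass.

Section AlgebraStructure.
Variables (k : fieldType) (A : algebra k).
HB.instance Definition _ := GRing.PzRing.on (alg_car A).
HB.instance Definition _ := GRing.Zmodule_isLmodule.Build k (alg_car A)
  (@alg_scaleA k A) (@alg_scale1 k A) (@alg_scaleDr k A) (@alg_scaleDl k A).

Lemma algZl (c : k) (x y : A) : c *: (x * y) = (c *: x) * y.
Proof. exact: alg_scaleAl. Qed.

Lemma algZr (c : k) (x y : A) : c *: (x * y) = x * (c *: y).
Proof. exact: alg_scaleAr. Qed.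
End AlgebraStructure.

Definition algebra_of_algType (k : fieldType) (A : algType k) : algebra k :=
  @Algebra k A *:%R (@scalerA k A) (@scale1r k A) (@scalerDr k A)
    (fun x a b => scalerDl x a b) (@scalerAl k A) (@scalerAr k A).

Section LinearHom.
Variables (k : fieldType) (U V : lmodType k).
Implicit Types f g h : {linear U -> V}.

Lemma linear_ext f g : f =1 g -> f = g.
Proof.
case: f g => [f [[[cf0 cfD]] [cf2]]] [g [[[cg0 cgD]] [cg2]]] /= /funext fg.
case: _ / fg in cg0 cgD cg2 *.
by rewrite (Prop_irrelevance cf0 cg0) (Prop_irrelevance cfD cgD)
  (Prop_irrelevance cf2 cg2).
Qed.

HB.instance Definition _ := gen_eqMixin {linear U -> V}.
HB.instance Definition _ := gen_choiceMixin {linear U -> V}.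

Definition hom_zero : {linear U -> V} := \0.
Definition hom_opp f : {linear U -> V} := \- f.
Definition hom_add f g : {linear U -> V} := f \+ g.
Definition hom_scale (c : k) f : {linear U -> V} := c \*: f.

Fact hom_addA : associative hom_add.
Proof. by move=> f g h; apply: linear_ext => x /=; rewrite addrA. Qed.
Fact hom_addC : commutative hom_add.
Proof. by move=> f g; apply: linear_ext => x /=; rewrite addrC. Qed.
Fact hom_add0 : left_id hom_zero hom_add.
Proof. by move=> f; apply: linear_ext => x /=; rewrite add0r. Qed.
Fact hom_addN : left_inverse hom_zero hom_opp hom_add.
Proof. by move=> f; apply: linear_ext => x /=; rewrite addNr. Qed.
HB.instance Definition _ := GRing.isZmodule.Build {linear U -> V}
  hom_addA hom_addC hom_add0 hom_addN.

Fact hom_scaleA a b f : hom_scale a (hom_scale b f) = hom_scale (a * b) f.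
Proof. by apply: linear_ext => x /=; rewrite scalerA. Qed.
Fact hom_scale1 : left_id 1 hom_scale.
Proof. by move=> f; apply: linear_ext => x /=; rewrite scale1r. Qed.
Fact hom_scaleDr : right_distributive hom_scale +%R.
Proof. by move=> c f g; apply: linear_ext => x /=; rewrite scalerDr. Qed.
Fact hom_scaleDl f : {morph hom_scale^~ f : a b / a + b}.
Proof. by move=> a b; apply: linear_ext => x /=; rewrite scalerDl. Qed.
HB.instance Definition _ := GRing.Zmodule_isLmodule.Build k {linear U -> V}
  hom_scaleA hom_scale1 hom_scaleDr hom_scaleDl.

End LinearHom.

Section Kernel.
Variables (k : fieldType) (U V : lmodType k) (f : {linear U -> V}).

Definition in_kernel : {pred U} := fun x => f x == 0.

Fact in_kernel_submod : submod_closed in_kernel.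
Proof.
split=> [|c x y]; rewrite !unfold_in ?linear0 //.
by rewrite linearP => /eqP-> /eqP->; rewrite scaler0 addr0.
Qed.
HB.instance Definition _ := GRing.isSubmodClosed.Build k U in_kernel
  in_kernel_submod.

Record kernel := Kernel { kernel_val :> U; _ : kernel_val \in in_kernel }.
HB.instance Definition _ := [isSub for kernel_val].
HB.instance Definition _ := [Choice of kernel by <:].
HB.instance Definition _ := [SubChoice_isSubLmodule of kernel by <:].

Fact kernel_proof (x : U) (fx0 : f x = 0) : x \in in_kernel.
Proof. by apply/eqP. Qed.
Definition to_kernel (x : U) (fx0 : f x = 0) : kernel :=
  Kernel (kernel_proof fx0).
End Kernel.

Section SpanQuotient.
Variables (k : fieldType) (V : lmodType k) (r : V -> Prop).

Inductive span : V -> Prop :=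
| span_zero : span 0
| span_cons (c : k) (u v : V) : r u -> span v -> span (c *: u + v).

Definition in_span : {pred V} := fun v => `[< span v >].

Fact in_span_submod : submod_closed in_span.
Proof.
split=> [|c x y]; rewrite !unfold_in; first exact/asboolP/span_zero.
move=> /asboolP sx /asboolP sy; apply/asboolP.
elim: sx => [|d u v ru _ IH]; first by rewrite scaler0 add0r.
by rewrite scalerDr scalerA -addrA; apply: span_cons.
Qed.
HB.instance Definition _ := GRing.isSubmodClosed.Build k V in_span
  in_span_submod.

(* The quotient V / span r. *)
Definition quotmod := Quotient.quot in_span.
HB.instance Definition _ := GRing.Zmodule.on quotmod.
HB.instance Definition _ := ZmodQuotient.on quotmod.

Definition quot_class (x : V) : quotmod := \pi_quotmod x.

Lemma quot_classP (x y : V) : quot_class x = quot_class y <-> span (x - y).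
Proof.
split=> [/eqP|s]; first by rewrite -Quotient.idealrBE => /asboolP.
by apply/eqP; rewrite -Quotient.idealrBE; apply/asboolP.
Qed.

Lemma quot_classW (P : quotmod -> Prop) :
  (forall x, P (quot_class x)) -> forall x, P x.
Proof. by move=> h x; rewrite -[x]reprK; apply: h. Qed.

Fact quot_classD : {morph quot_class : x y / x + y}.
Proof. by move=> x y; rewrite /quot_class raddfD. Qed.

Definition quot_scale (c : k) (x : quotmod) : quotmod := quot_class (c *: repr x).

Fact quot_scaleE c x : quot_scale c (quot_class x) = quot_class (c *: x).
Proof.
apply/quot_classP; rewrite -scalerBr; apply/asboolP.
have: repr (quot_class x) - x \in in_span.
  by apply/asboolP/quot_classP; rewrite /quot_class reprK.
by move=> h; apply: (rpredZ c) h.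
Qed.

Fact quot_scaleA a b x : quot_scale a (quot_scale b x) = quot_scale (a * b) x.
Proof. by elim/quot_classW: x => x; rewrite !quot_scaleE scalerA. Qed.
Fact quot_scale1 : left_id 1 quot_scale.
Proof. by elim/quot_classW => x; rewrite quot_scaleE scale1r. Qed.
Fact quot_scaleDr : right_distributive quot_scale +%R.
Proof.
move=> c; elim/quot_classW => x; elim/quot_classW => y.
by rewrite -quot_classD !quot_scaleE scalerDr quot_classD.
Qed.
Fact quot_scaleDl x : {morph quot_scale^~ x : a b / a + b}.
Proof.
by elim/quot_classW: x => x a b; rewrite !quot_scaleE scalerDl quot_classD.
Qed.
HB.instance Definition _ := GRing.Zmodule_isLmodule.Build k quotmod
  quot_scaleA quot_scale1 quot_scaleDr quot_scaleDl.

Fact quot_class_linear : linear quot_class.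
Proof. by move=> c x y; rewrite quot_classD -quot_scaleE. Qed.
HB.instance Definition _ := GRing.isLinear.Build k V quotmod *:%R quot_class
  quot_class_linear.

Section Lift.
Variables (W : lmodType k) (f : {linear V -> W}).
Hypothesis f_r : forall u, r u -> f u = 0.

Definition quot_lift_fun (x : quotmod) : W := f (repr x).

Fact quot_lift_funE x : quot_lift_fun (quot_class x) = f x.
Proof.
apply/eqP; rewrite -subr_eq0 -linearB; apply/eqP.
have: span (repr (quot_class x) - x) by apply/quot_classP; rewrite /quot_class reprK.
elim=> [|c u v ru _ IH]; first exact: linear0.
by rewrite linearP f_r // IH scaler0 addr0.
Qed.

Fact quot_lift_linear : linear quot_lift_fun.
Proof.
move=> c; elim/quot_classW => x; elim/quot_classW => y.
have <- : quot_class (c *: x + y) = c *: quot_class x + quot_class y.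
  exact: linearP.
by rewrite !quot_lift_funE linearP.
Qed.
HB.instance Definition _ := GRing.isLinear.Build k quotmod W *:%R quot_lift_fun
  quot_lift_linear.

Definition quot_lift : {linear quotmod -> W} :=
  locked (quot_lift_fun : {linear quotmod -> W}).

Lemma quot_liftE x : quot_lift (quot_class x) = f x.
Proof. by rewrite /quot_lift -lock; apply: quot_lift_funE. Qed.
End Lift.

End SpanQuotient.

Section FreeModule.
Variables (k : fieldType) (X : choiceType).

Definition freemod := {freeg X / k}.
HB.instance Definition _ := GRing.Lmodule.on freemod.

Definition gen (x : X) : freemod := << x >>.

Section FreeLift.
Variables (W : lmodType k) (f : X -> W).

Fact free_lift_linear : linear (fglift f : freemod -> W).
Proof.
have add := lift_is_additive f.
have addD (D E : freemod) : fglift f (D + E) = fglift f D + fglift f E.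
  have f0 : fglift f 0 = 0 by rewrite -[X in fglift f X](subrr 0) add subrr.
  have fN F : fglift f (- F) = - fglift f F by rewrite -(sub0r F) add f0 sub0r.
  by rewrite -[E in LHS]opprK add fN opprK.
move=> c D E; rewrite addD; congr (_ + _).
have f0 : fglift f 0 = 0 by rewrite -[X in fglift f X](subrr 0) add subrr.
have sumD (s : seq X) (g : X -> k) :
    fglift f (\sum_(x <- s) << g x *g x >>) = \sum_(x <- s) g x *: f x.
  elim: s => [|x s IH]; first by rewrite !big_nil f0.
  by rewrite !big_cons addD IH liftU.
rewrite -[X in _ = _ *: fglift f X](freeg_sumE D) [LHS]sumD sumD scaler_sumr.
by apply: eq_bigr => x _; rewrite scalerA.
Qed.
HB.instance Definition _ := GRing.isLinear.Build k freemod W *:%R (fglift f)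
  free_lift_linear.

Definition free_lift : {linear freemod -> W} :=
  locked (fglift f : {linear freemod -> W}).

Lemma free_liftE x : free_lift (gen x) = f x.
Proof. by rewrite /free_lift -lock /= liftU scale1r. Qed.
End FreeLift.

Lemma free_ext (W : lmodType k) (f g : {linear freemod -> W}) :
  (forall x, f (gen x) = g (gen x)) -> f =1 g.
Proof.
move=> fg D; rewrite -(freeg_sumE D) !linear_sum; apply: eq_bigr => x _.
have -> : << coeff x D *g x >> = coeff x D *: gen x :> freemod.
  by apply/eqP/freeg_eqP => y; rewrite coeffZ !coeffU mul1r.
by rewrite !linearZ fg.
Qed.
End FreeModule.

(* k acts centrally on bimodules: both actions are k-bilinear. *)
Record bimodule (k : fieldType) (A B : algebra k) := Bimodule {
  bimod_car :> lmodType k;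
  lact : A -> bimod_car -> bimod_car;
  ract : bimod_car -> B -> bimod_car;
  lact_linearl : forall x, linear (lact^~ x);
  lact_linearr : forall a, linear (lact a);
  lact1 : forall x, lact 1 x = x;
  lactA : forall a b x, lact a (lact b x) = lact (a * b) x;
  ract_linearl : forall b, linear (ract^~ b);
  ract_linearr : forall x, linear (ract x);
  ract1 : forall x, ract x 1 = x;
  ractA : forall x a b, ract (ract x a) b = ract x (a * b);
  lractA : forall a x b, ract (lact a x) b = lact a (ract x b)
}.

Record bimod_iso (k : fieldType) (A B : algebra k) (M N : bimodule A B) :=
  BimodIso {
  iso_fun :> {linear M -> N};
  iso_lact : forall a x, iso_fun (lact a x) = lact a (iso_fun x);
  iso_ract : forall x b, iso_fun (ract x b) = ract (iso_fun x) b;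
  iso_bij : bijective iso_fun
}.

Section Regular.
Variables (k : fieldType) (A : algebra k).

Fact mul_linearl (x : A) : linear (fun a : A => a * x).
Proof. by move=> c a b /=; rewrite mulrDl algZl. Qed.
Fact mul_linearr (a : A) : linear (fun x : A => a * x).
Proof. by move=> c x y /=; rewrite mulrDr algZr. Qed.
Fact mulA_assoc (a b x : A) : a * (b * x) = (a * b) * x.
Proof. exact: mulrA. Qed.
Fact mulA_assoc' (a b x : A) : (a * b) * x = a * (b * x).
Proof. by rewrite mulrA. Qed.

Definition regular : bimodule A A :=
  @Bimodule k A A A *%R *%R mul_linearl mul_linearr (@mul1r _) mulA_assoc
    mul_linearl mul_linearr (@mulr1 _) mulA_assoc' mulA_assoc'.
End Regular.

Section Tensor.
Variables (k : fieldType) (A B C : algebra k).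
Variables (M : bimodule A B) (N : bimodule B C).

Let F := freemod k (M * N)%type.
Let g (x : M) (y : N) : F := gen k (x, y).

Inductive tensor_rel : F -> Prop :=
| tensor_rel_l c x x' y : tensor_rel (g (c *: x + x') y - (c *: g x y + g x' y))
| tensor_rel_r c x y y' : tensor_rel (g x (c *: y + y') - (c *: g x y + g x y'))
| tensor_rel_mid x b y : tensor_rel (g (ract x b) y - g x (lact b y)).

Definition tensor_car := quotmod tensor_rel.

Definition tens (x : M) (y : N) : tensor_car := quot_class tensor_rel (g x y).

Lemma tens_linearl y : linear (tens^~ y).
Proof.
move=> c x x'; rewrite /tens -linearP; apply/quot_classP.
by rewrite -[_ - _]scale1r -[_ *: _]addr0;
  do ![constructor].
Qed.

Lemma tens_linearr x : linear (tens x).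
Proof.
move=> c y y'; rewrite /tens -linearP; apply/quot_classP.
by rewrite -[_ - _]scale1r -[_ *: _]addr0;
  do ![constructor].
Qed.

Lemma tens_mid x b y : tens (ract x b) y = tens x (lact b y).
Proof.
apply/quot_classP; rewrite -[_ - _]scale1r -[_ *: _]addr0.
by do ![constructor].
Qed.

Section TensorLift.
Variables (W : lmodType k) (h : M -> N -> W).
Hypothesis h_l : forall y, linear (h^~ y).
Hypothesis h_r : forall x, linear (h x).
Hypothesis h_mid : forall x b y, h (ract x b) y = h x (lact b y).

Fact tensor_lift_rel u :
  tensor_rel u -> free_lift (fun z : (M * N)%type => h z.1 z.2) u = 0.
Proof.
case=> [c x x' y|c x y y'|x b y]; rewrite linearB ?[X in _ - X]linearP /g !free_liftE /=.
- by rewrite h_l subrr.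
- by rewrite h_r subrr.
- by rewrite h_mid subrr.
Qed.

Definition tensor_lift : {linear tensor_car -> W} := quot_lift tensor_lift_rel.

Lemma tensor_liftE x y : tensor_lift (tens x y) = h x y.
Proof. by rewrite /tensor_lift quot_liftE free_liftE. Qed.
End TensorLift.

Lemma tensor_ext (W : lmodType k) (f f' : {linear tensor_car -> W}) :
  (forall x y, f (tens x y) = f' (tens x y)) -> f =1 f'.
Proof.
move=> ff'; elim/quot_classW => x.
apply: (@free_ext k _ W (f \o quot_class tensor_rel)
  (f' \o quot_class tensor_rel)) => -[y z]; exact: ff'.
Qed.

Section Actions.
Variables (a : A) (c : C).

Fact tensor_lact_l y : linear (fun x => tens (lact a x) y).
Proof. by move=> d x x'; rewrite lact_linearr tens_linearl. Qed.
Fact tensor_lact_r x : linear (fun y => tens (lact a x) y).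
Proof. by move=> d y y'; rewrite tens_linearr. Qed.
Fact tensor_lact_mid x b y :
  tens (lact a (ract x b)) y = tens (lact a x) (lact b y).
Proof. by rewrite -lractA tens_mid. Qed.
Fact tensor_ract_l y : linear (fun x => tens x (ract y c)).
Proof. by move=> d x x'; rewrite tens_linearl. Qed.
Fact tensor_ract_r x : linear (fun y => tens x (ract y c)).
Proof. by move=> d y y'; rewrite ract_linearl tens_linearr. Qed.
Fact tensor_ract_mid x b y :
  tens (ract x b) (ract y c) = tens x (ract (lact b y) c).
Proof. by rewrite lractA tens_mid. Qed.

Definition tensor_lact : {linear tensor_car -> tensor_car} :=
  tensor_lift tensor_lact_l tensor_lact_r tensor_lact_mid.
Definition tensor_ract : {linear tensor_car -> tensor_car} :=
  tensor_lift tensor_ract_l tensor_ract_r tensor_ract_mid.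

Lemma tensor_lactE x y : tensor_lact (tens x y) = tens (lact a x) y.
Proof. exact: tensor_liftE. Qed.
Lemma tensor_ractE x y : tensor_ract (tens x y) = tens x (ract y c).
Proof. exact: tensor_liftE. Qed.
End Actions.

Let rt t c := tensor_ract c t.

Fact tensor_lact_linearl t : linear (tensor_lact^~ t).
Proof.
move=> c a b; rewrite -[RHS]/((c \*: tensor_lact a \+ tensor_lact b) t).
apply: tensor_ext t => x y /=.
by rewrite !tensor_lactE lact_linearl tens_linearl.
Qed.
Fact tensor_lact_linearr a : linear (tensor_lact a).
Proof. exact: linearP. Qed.
Fact tensor_lact1 t : tensor_lact 1 t = t.
Proof.
rewrite -[RHS]/(idfun t); apply: tensor_ext t => x y /=.
by rewrite tensor_lactE lact1.
Qed.
Fact tensor_lactA a b t : tensor_lact a (tensor_lact b t) = tensor_lact (a * b) t.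
Proof.
rewrite -[LHS]/((tensor_lact a \o tensor_lact b) t).
by apply: tensor_ext t => x y /=; rewrite !tensor_lactE lactA.
Qed.
Fact tensor_ract_linearl c : linear (rt^~ c).
Proof. exact: linearP. Qed.
Fact tensor_ract_linearr t : linear (rt t).
Proof.
move=> c a b; rewrite /rt -[RHS]/((c \*: tensor_ract a \+ tensor_ract b) t).
apply: tensor_ext t => x y /=.
by rewrite !tensor_ractE ract_linearr tens_linearr.
Qed.
Fact tensor_ract1 t : rt t 1 = t.
Proof.
rewrite /rt -[RHS]/(idfun t); apply: tensor_ext t => x y /=.
by rewrite tensor_ractE ract1.
Qed.
Fact tensor_ractA t a b : rt (rt t a) b = rt t (a * b).
Proof.
rewrite /rt -[LHS]/((tensor_ract b \o tensor_ract a) t).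
by apply: tensor_ext t => x y /=; rewrite !tensor_ractE ractA.
Qed.
Fact tensor_lractA a t c : rt (tensor_lact a t) c = tensor_lact a (rt t c).
Proof.
rewrite /rt -[LHS]/((tensor_ract c \o tensor_lact a) t).
rewrite -[RHS]/((tensor_lact a \o tensor_ract c) t).
by apply: tensor_ext t => x y /=; rewrite !(tensor_ractE, tensor_lactE).
Qed.

Definition tensor : bimodule A C :=
  Bimodule tensor_lact_linearl tensor_lact_linearr tensor_lact1 tensor_lactA
    tensor_ract_linearl tensor_ract_linearr tensor_ract1 tensor_ractA
    tensor_lractA.

End Tensor.

Section TensorPower.
Variables (k : fieldType) (n : nat) (V : lmodType k).
Implicit Types x y z : 'I_n -> V.

(* z = (.., c v + w, ..), x = (.., v, ..), y = (.., w, ..), position i *)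
Definition splits_at (i : 'I_n) (c : k) x y z :=
  z i = c *: x i + y i /\ forall j, j != i -> z j = x j /\ z j = y j.

Definition multilinear (W : lmodType k) (h : ('I_n -> V) -> W) :=
  forall i c x y z, splits_at i c x y z -> h z = c *: h x + h y.

Let F := freemod k ('I_n -> V).
Let g x : F := gen k x.

Inductive tpow_rel : F -> Prop :=
| TpowRel i c x y z of splits_at i c x y z : tpow_rel (g z - (c *: g x + g y)).

(* The tensor power of V over k, k itself (up to isomorphism) when n = 0. *)
Definition tpow := quotmod tpow_rel.

Definition ptens x : tpow := quot_class tpow_rel (g x).

Lemma ptens_multilinear : multilinear ptens.
Proof.
move=> i c x y z xyz; rewrite /ptens -linearP; apply/quot_classP.
rewrite -[_ - _]scale1r -[_ *: _]addr0.
by apply: span_cons (span_zero _); apply: TpowRel xyz.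
Qed.

Section TpowLift.
Variables (W : lmodType k) (h : ('I_n -> V) -> W).
Hypothesis h_lin : multilinear h.

Fact tpow_lift_rel u : tpow_rel u -> free_lift h u = 0.
Proof.
case=> i c x y z xyz.
by rewrite linearB [X in _ - X]linearP /g !free_liftE (h_lin xyz) subrr.
Qed.

Definition tpow_lift : {linear tpow -> W} := quot_lift tpow_lift_rel.

Lemma tpow_liftE x : tpow_lift (ptens x) = h x.
Proof. by rewrite /tpow_lift quot_liftE free_liftE. Qed.
End TpowLift.

Lemma tpow_ext (W : lmodType k) (f f' : {linear tpow -> W}) :
  (forall x, f (ptens x) = f' (ptens x)) -> f = f'.
Proof.
move=> ff'; apply: linear_ext; elim/quot_classW => x.
apply: (@free_ext k _ W (f \o quot_class tpow_rel)
  (f' \o quot_class tpow_rel)) => y; exact: ff'.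
Qed.

End TensorPower.

Section Hochschild.
Variables (k : fieldType) (A : algebra k).

Definition cochain (n : nat) := {linear tpow n A -> A}.
HB.instance Definition _ n := GRing.Lmodule.on (cochain n).

Section Differential.
Variable n : nat.

Definition tail (a : 'I_n.+1 -> A) : 'I_n -> A := fun i => a (lift ord0 i).
Definition front (a : 'I_n.+1 -> A) : 'I_n -> A :=
  fun i => a (widen_ord (leqnSn n) i).

(* (a_0, .., a_n) |-> (a_0, .., a_j a_(j+1), .., a_n), for 0 <= j < n *)
Definition contract (j : 'I_n) (a : 'I_n.+1 -> A) : 'I_n -> A := fun i =>
  if (i < j)%N then front a i
  else if i == j then front a i * tail a i else tail a i.

Section Splitting.
Variables (i : 'I_n.+1) (c : k) (x y z : 'I_n.+1 -> A).
Hypothesis xyz : splits_at i c x y z.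

Fact tail_fixed : i = ord0 -> tail z = tail x /\ tail z = tail y.
Proof.
move=> i0; split; apply/funext => l; rewrite /tail;
  by case: (xyz.2 (lift ord0 l)) => //; rewrite i0 eq_sym neq_lift.
Qed.

Fact tail_splits (i' : 'I_n) :
  i = lift ord0 i' -> splits_at i' c (tail x) (tail y) (tail z).
Proof.
case: xyz => zi zj def_i; rewrite /tail; split; first by rewrite -def_i.
by move=> j ji; apply: zj; rewrite def_i (inj_eq lift_inj).
Qed.

Fact front_fixed : i = ord_max -> front z = front x /\ front z = front y.
Proof.
move=> im; split; apply/funext => l; rewrite /front;
  by case: (xyz.2 (widen_ord (leqnSn n) l)) => //;
     rewrite im -val_eqE /= neq_ltn ltn_ord.
Qed.

Fact front_splits (i' : 'I_n) :
  i = widen_ord (leqnSn n) i' -> splits_at i' c (front x) (front y) (front z).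
Proof.
case: xyz => zi zj def_i; rewrite /front; split; first by rewrite -def_i.
by move=> j ji; apply: zj; rewrite def_i.
Qed.

Fact contract_splits (j : 'I_n) :
  exists i', splits_at i' c (contract j x) (contract j y) (contract j z).
Proof.
case: xyz => zi zj.
have zj' (l : 'I_n.+1) : (l != i :> nat) -> z l = x l /\ z l = y l.
  by move=> li; apply: zj.
have lt_n : (i - (j < i) < n)%N by have := ltn_ord i; have := ltn_ord j; lia.
exists (Ordinal lt_n); split=> [|l]; last first.
  rewrite -val_eqE /= => li; rewrite /contract /front /tail.
  have [lj|jl|lj] := ltngtP l j.
  - by apply: zj' => /=; lia.
  - rewrite -val_eqE /= gtn_eqF //; apply: zj'; rewrite lift0; lia.
  - have -> : (l == j) = true by apply/eqP/val_inj.
    have [|-> ->] := zj' (widen_ord (leqnSn n) l); first by move=> /=; lia.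
    by have [|-> ->] := zj' (lift ord0 l); first by rewrite lift0; lia.
have at_i (l : 'I_n.+1) : l = i :> nat -> z l = c *: x l + y l.
  by move=> li; rewrite (_ : l = i) //; apply: val_inj.
rewrite /contract /front /tail; set i' := Ordinal lt_n.
have def_i' : i' = (i - (j < i))%N :> nat by [].
have [lj|jl|lj] := ltngtP i' j.
- by apply: at_i => /=; lia.
- by rewrite -val_eqE /= gtn_eqF //; apply: at_i; rewrite lift0 /=; lia.
- have -> : (i' == j) = true by apply/eqP/val_inj.
  have [ji|ij] := ltnP j i.
  + have [|<- <-] := zj' (widen_ord (leqnSn n) i'); first by move=> /=; lia.
    by rewrite (at_i (lift ord0 i')) ?lift0 /= ?mulrDr ?algZr //; lia.
  + have [|<- <-] := zj' (lift ord0 i'); first by rewrite lift0 /=; lia.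
    by rewrite (at_i (widen_ord (leqnSn n) i')) /= ?mulrDl ?algZl //; lia.
Qed.
End Splitting.

Definition hoch_fun (f : cochain n) (a : 'I_n.+1 -> A) : A :=
  a ord0 * f (ptens (tail a))
  + \sum_(j < n) (-1) ^+ j.+1 *: f (ptens (contract j a))
  + (-1) ^+ n.+1 *: (f (ptens (front a)) * a ord_max).

Fact hoch_fun_multilinear f : multilinear (hoch_fun f).
Proof.
move=> i c x y z xyz; rewrite /hoch_fun.
have lin_f u v w l : splits_at l c u v w ->
    f (ptens w) = c *: f (ptens u) + f (ptens v).
  by move=> uvw; rewrite (ptens_multilinear uvw) linearP.
have tailE : z ord0 * f (ptens (tail z)) =
    c *: (x ord0 * f (ptens (tail x))) + y ord0 * f (ptens (tail y)).
  have [i0|[i' def_i]] : i = ord0 \/ exists i', i = lift ord0 i'.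
  - by case: (unliftP ord0 i) => [i'|] ->; [right; exists i' | left].
  - have [zx zy] := tail_fixed xyz i0.
    by rewrite -zx -zy -i0 xyz.1 mulrDl algZl.
  - rewrite (lin_f _ _ _ _ (tail_splits xyz def_i)) mulrDr -algZr.
    by case: (xyz.2 ord0) => [|<- <-]; rewrite // def_i neq_lift.
have frontE : f (ptens (front z)) * z ord_max =
    c *: (f (ptens (front x)) * x ord_max) + f (ptens (front y)) * y ord_max.
  have [im|[i' def_i]] : i = ord_max \/ exists i', i = widen_ord (leqnSn n) i'.
  - case: (ltnP i n) => [lt_in|le_ni]; [right; exists (Ordinal lt_in)|left];
      apply: val_inj => //=.
    by apply/eqP; rewrite eqn_leq le_ni -ltnS ltn_ord.
  - have [zx zy] := front_fixed xyz im.
    by rewrite -zx -zy -im xyz.1 mulrDr algZr.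
  - rewrite (lin_f _ _ _ _ (front_splits xyz def_i)) mulrDl -algZl.
    case: (xyz.2 ord_max) => [|<- <-] //.
    by rewrite def_i -val_eqE /= neq_ltn ltn_ord orbT.
have contrE (j : 'I_n) : (-1) ^+ j.+1 *: f (ptens (contract j z)) =
    c *: ((-1) ^+ j.+1 *: f (ptens (contract j x)))
    + (-1) ^+ j.+1 *: f (ptens (contract j y)).
  have [l /lin_f->] := contract_splits xyz j.
  by rewrite scalerDr !scalerA mulrC.
rewrite tailE frontE (eq_bigr _ (fun j _ => contrE j)) big_split -scaler_sumr /=.
rewrite [X in _ + X]scalerDr scalerA (mulrC _ c) -scalerA.
by rewrite !(scalerDr c) [RHS]addrACA; congr (_ + _); rewrite addrACA.
Qed.


Definition hoch_d_fun (f : cochain n) : cochain n.+1 :=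
  tpow_lift (hoch_fun_multilinear f).

Lemma hoch_dE f a : hoch_d_fun f (ptens a) = hoch_fun f a.
Proof. exact: tpow_liftE. Qed.

Fact hoch_d_linear : linear hoch_d_fun.
Proof.
move=> c f g; apply: tpow_ext => a /=; rewrite !hoch_dE /hoch_fun /=.
have contrE (j : 'I_n) : (-1) ^+ j.+1 *: (c *: f (ptens (contract j a))
      + g (ptens (contract j a))) =
    c *: ((-1) ^+ j.+1 *: f (ptens (contract j a)))
    + (-1) ^+ j.+1 *: g (ptens (contract j a)).
  by rewrite scalerDr !scalerA mulrC.
rewrite (eq_bigr _ (fun j _ => contrE j)) big_split -scaler_sumr /=.
rewrite mulrDr mulrDl -algZr -algZl [X in _ + X]scalerDr.
rewrite [(-1) ^+ n.+1 *: (c *: _)]scalerA (mulrC _ c) -scalerA.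
by rewrite !(scalerDr c) [RHS]addrACA; congr (_ + _); rewrite addrACA.
Qed.
HB.instance Definition _ := GRing.isLinear.Build k (cochain n) (cochain n.+1)
  *:%R hoch_d_fun hoch_d_linear.

Definition hoch_d : {linear cochain n -> cochain n.+1} := hoch_d_fun.
End Differential.

Definition coboundary (n : nat) : cochain n -> Prop :=
  match n with
  | 0 => fun f => f = 0
  | n'.+1 => fun f => exists g : cochain n', f = hoch_d n' g
  end.

Definition cocycle (n : nat) := kernel (hoch_d n).

Definition HH (n : nat) :=
  quotmod (fun z : cocycle n => coboundary (kernel_val z)).

Definition HH_class (n : nat) (f : cochain n) (df0 : hoch_d n f = 0) : HH n :=
  quot_class _ (to_kernel df0).

End Hochschild.

Record morita_data (k : fieldType) (A B : algebra k) := MoritaData {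
  mP : bimodule A B;
  mQ : bimodule B A;
  pairA : bimod_iso (tensor mP mQ) (regular A);
  pairB : bimod_iso (tensor mQ mP) (regular B);
  pairA_assoc : forall (p p' : mP) (q : mQ),
    lact (pairA (tens p q)) p' = ract p (pairB (tens q p'));
  pairB_assoc : forall (q q' : mQ) (p : mP),
    lact (pairB (tens q p)) q' = ract q (pairA (tens p q'))
}.

Definition brA (k : fieldType) (A B : algebra k) (M : morita_data A B)
  (p : mP M) (q : mQ M) : A := pairA M (tens p q).
Definition brB (k : fieldType) (A B : algebra k) (M : morita_data A B)
  (q : mQ M) (p : mP M) : B := pairB M (tens q p).

Section Transfer.
Variables (k : fieldType) (A B : algebra k).
Variables (P : bimodule A B) (Q : bimodule B A).
Variables (prA : {linear tensor P Q -> regular A}).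
Variables (prB : {linear tensor Q P -> regular B}).
Variables (m : nat) (p : 'I_m -> P) (q : 'I_m -> Q).
Variables (n : nat) (f : cochain A n).

Definition transfer_arg (i : {ffun 'I_n.+1 -> 'I_m}) (b : 'I_n -> B)
    : 'I_n -> A := fun l =>
  prA (tens (p (i (widen_ord (leqnSn n) l))) (lact (b l) (q (i (lift ord0 l))))).

Definition transfer_fun (b : 'I_n -> B) : B :=
  \sum_(i : {ffun 'I_n.+1 -> 'I_m})
    (prB (tens (q (i ord0))
               (lact (f (ptens (transfer_arg i b))) (p (i ord_max)))) : B).

Fact transfer_fun_multilinear : multilinear transfer_fun.
Proof.
move=> l c x y z [zl zj]; rewrite /transfer_fun scaler_sumr -big_split /=.
apply: eq_bigr => i _.
have arg : splits_at l c (transfer_arg i x) (transfer_arg i y)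
    (transfer_arg i z).
  split=> [|j /zj [zx zy]]; last by rewrite /transfer_arg -zx -zy.
  by rewrite /transfer_arg zl lact_linearl tens_linearr linearP.
by rewrite (ptens_multilinear arg) linearP lact_linearl tens_linearr linearP.
Qed.

Definition transfer : cochain B n := tpow_lift transfer_fun_multilinear.
End Transfer.

Section TransferMaps.
Variables (k : fieldType) (A B : algebra k) (M : morita_data A B).

Definition phi m (p : 'I_m -> mP M) (q : 'I_m -> mQ M) n (f : cochain A n)
  : cochain B n := transfer (pairA M) (pairB M) p q f.

Definition psi m (p : 'I_m -> mP M) (q : 'I_m -> mQ M) n (g : cochain B n)
  : cochain A n := transfer (pairB M) (pairA M) q p g.

Lemma phiE m (p : 'I_m -> mP M) (q : 'I_m -> mQ M) n (f : cochain A n) b :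
  phi p q f (ptens b) = \sum_(i : {ffun 'I_n.+1 -> 'I_m})
    brB (q (i ord0)) (lact (f (ptens (fun l : 'I_n =>
      brA (p (i (widen_ord (leqnSn n) l))) (lact (b l) (q (i (lift ord0 l)))))))
      (p (i ord_max))).
Proof. exact: tpow_liftE. Qed.

Lemma psiE m (p : 'I_m -> mP M) (q : 'I_m -> mQ M) n (g : cochain B n) a :
  psi p q g (ptens a) = \sum_(j : {ffun 'I_n.+1 -> 'I_m})
    brA (p (j ord0)) (lact (g (ptens (fun l : 'I_n =>
      brB (q (j (widen_ord (leqnSn n) l))) (lact (a l) (p (j (lift ord0 l)))))))
      (q (j ord_max))).
Proof. exact: tpow_liftE. Qed.
End TransferMaps.

(* In degree 0, evaluation at the empty tensor identifies Hom(k, A) with A;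
   the next lemmas give d^1, phi^0 and psi^0 in these terms. *)
Section DegreeZero.
Variables (k : fieldType) (A : algebra k).

Definition unit_tens : tpow 0 A := ptens (fun=> 0).

Lemma ptens0 (x : 'I_0 -> A) : ptens x = unit_tens.
Proof. by congr ptens; apply/funext => -[]. Qed.

Fact const_multilinear (a : A) : multilinear (fun _ : 'I_0 -> A => a).
Proof. by case. Qed.

Definition cochain0 (a : A) : cochain A 0 := tpow_lift (const_multilinear a).

Lemma cochain0E a : cochain0 a unit_tens = a.
Proof. exact: tpow_liftE. Qed.

Lemma cochain0K (f : cochain A 0) : cochain0 (f unit_tens) = f.
Proof. by apply: tpow_ext => x; rewrite ptens0 cochain0E. Qed.

Lemma hoch_d0E (x : A) (a : 'I_1 -> A) :
  hoch_d A 0 (cochain0 x) (ptens a) = a ord0 * x - x * a ord0.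
Proof.
rewrite [LHS]hoch_dE /hoch_fun !ptens0 cochain0E big_ord0 addr0 expr1 scaleN1r.
by rewrite (ord1 ord_max).
Qed.
End DegreeZero.

Section DegreeZeroTransfer.
Variables (k : fieldType) (A B : algebra k) (M : morita_data A B).
Variables (m : nat) (p : 'I_m -> mP M) (q : 'I_m -> mQ M).

Fact sum_ffun1 (V : nmodType) (F : 'I_m -> V) :
  \sum_(i : {ffun 'I_1 -> 'I_m}) F (i ord0) = \sum_i F i.
Proof.
rewrite (reindex (fun i : 'I_m => [ffun _ : 'I_1 => i])).
  by apply: eq_bigr => i _; rewrite ffunE.
exists (fun i : {ffun 'I_1 -> 'I_m} => i ord0) => i _; first by rewrite ffunE.
by apply/ffunP => j; rewrite ffunE (ord1 j).
Qed.

Lemma phi0E (a : A) :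
  phi p q (cochain0 a) (unit_tens B) = \sum_i brB (q i) (lact a (p i)).
Proof.
rewrite phiE -(sum_ffun1 (fun i => brB (q i) (lact a (p i)))).
by apply: eq_bigr => i _; rewrite ptens0 cochain0E (ord1 ord_max).
Qed.

Lemma psi0E (b : B) :
  psi p q (cochain0 b) (unit_tens A) = \sum_j brA (p j) (lact b (q j)).
Proof.
rewrite psiE -(sum_ffun1 (fun j => brA (p j) (lact b (q j)))).
by apply: eq_bigr => j _; rewrite ptens0 cochain0E (ord1 ord_max).
Qed.
End DegreeZeroTransfer.

(* Main.v *)
(* Cochains are handled as multilinear functions F on finite sequences.  There
   the transfer maps are defined by recursion on the sequence and commute with
   the differential: the inner indices disappear because
   sum_i <p, b q_i><p_i, b' q> = <p, b b' q>.  The composite psi o phi is the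
   self-transfer of A
     F |-> sum v_0 F(u_0 a_1 v_1, .., u_(n-1) a_n v_n) u_n
   with u_(i,j) = <p_i, q'_j>, v_(i,j) = <p'_j, q_i> and sum v u = 1.  It is
   homotopic to the identity through
     F |-> sum_s (-1)^s sum v_0 F(u_0 a_1 v_1, .., u_(s-1) a_s v_s, u_s, a_(s+1), ..),
   so it is the identity on cohomology.  The other composite follows by
   exchanging A and B. *)
From HB Require Import structures.
Require Import Defs.
From mathcomp Require Import all_boot all_order all_algebra boolp.

Set Implicit Arguments.
Unset Strict Implicit.
Unset Printing Implicit Defensive.

Import GRing.Theory.
Local Open Scope ring_scope.

(** * Inner and last faces of the Hochschild differential on sequences *)

Section FaceSum.
Variables (A : pzRingType) (N : zmodType) (act : N -> A -> N).
Implicit Types (F G : seq A -> N) (s : seq A).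

(* d F (a :: s) is a F s + face_sum F (a :: s).  Only the right action on the
   values enters, so that F may take its values in the right module P. *)
Fixpoint face_sum F s : N :=
  if s is a :: s' then
    if s' is b :: t then - F (a * b :: t) - face_sum (fun w => F (a :: w)) s'
    else - act (F [::]) a
  else 0.

Lemma face_sum_cons2 F a b t : face_sum F (a :: b :: t) =
  - F (a * b :: t) - face_sum (fun w => F (a :: w)) (b :: t).
Proof. by []. Qed.

Hypothesis actB : forall a, {morph act^~ a : x y / x - y}.

Fact face_act0 a : act 0 a = 0.
Proof. by have := actB a 0 0; rewrite !subrr. Qed.

Fact face_actD a : {morph act^~ a : x y / x + y}.
Proof.
have actN x : act (- x) a = - act x a by rewrite -sub0r actB face_act0 sub0r.
by move=> x y; rewrite -{1}[y]opprK actB actN opprK.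
Qed.

Lemma face_sumB F G s :
  face_sum (fun w => F w - G w) s = face_sum F s - face_sum G s.
Proof.
elim: s F G => [|a [|b t] IH] F G; first by rewrite subrr.
  by rewrite /= actB opprB opprK addrC.
rewrite !face_sum_cons2 (IH (fun w => F (a :: w)) (fun w => G (a :: w))).
by rewrite -!opprD addrACA -opprD.
Qed.

Lemma face_sum_sum (I : finType) (F : I -> seq A -> N) s :
  face_sum (fun w => \sum_i F i w) s = \sum_i face_sum (F i) s.
Proof.
elim: s F => [|a [|b t] IH] F; first by rewrite big1.
  by rewrite /= (big_morph (act^~ a) (face_actD a) (face_act0 a)) sumrN.
by rewrite !face_sum_cons2 (IH (fun i w => F i (a :: w))) -!sumrN -big_split.
Qed.

End FaceSum.

(** Serves to move a left factor across the faces: multiplication by [v i], and the pairing with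
    [q i], which turns the right action on [P] into multiplication in [B]. *)
Lemma face_sum_morph (A : pzRingType) (N N' : zmodType) (act : N -> A -> N)
    (act' : N' -> A -> N') (h : N -> N') F s :
  {morph h : y z / y - z} -> (forall y a, h (act y a) = act' (h y) a) ->
  face_sum act' (fun w => h (F w)) s = h (face_sum act F s).
Proof.
move=> hB hact.
have h0 : h 0 = 0 by have := hB 0 0; rewrite !subrr.
have hN y : h (- y) = - h y by rewrite -sub0r hB h0 sub0r.
elim: s F => [|a [|b t] IH] F //; first by rewrite /= hN hact.
by rewrite !face_sum_cons2 (IH (fun w => F (a :: w))) hB hN.
Qed.

(** * Maps that are linear in a function argument *)

Section PointwiseLinear.
Variables (k : fieldType) (T : Type) (V W : lmodType k) (h : (T -> V) -> W).
Hypothesis h_lin : forall c F G,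
  h (fun w => c *: F w + G w) = c *: h F + h G.

Lemma pointwise_linearD F G : h (fun w => F w + G w) = h F + h G.
Proof.
have -> : (fun w => F w + G w) = (fun w => 1 *: F w + G w).
  by apply/funext => w; rewrite scale1r.
by rewrite h_lin scale1r.
Qed.

Lemma pointwise_linear0 : h (fun=> 0) = 0.
Proof.
apply: (addrI (h (fun=> 0))); rewrite -pointwise_linearD [RHS]addr0; congr h.
by apply/funext => w; rewrite addr0.
Qed.

Lemma pointwise_linearN F : h (fun w => - F w) = - h F.
Proof.
have -> : (fun w => - F w) = (fun w => - 1 *: F w + 0).
  by apply/funext => w; rewrite addr0 scaleN1r.
by rewrite (h_lin _ _ (fun=> 0)) pointwise_linear0 addr0 scaleN1r.
Qed.

Lemma pointwise_linear_sum (I : finType) (F : I -> T -> V) :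
  h (fun w => \sum_i F i w) = \sum_i h (F i).
Proof.
elim: (index_enum I) => [|i r IH].
  rewrite big_nil -[RHS]pointwise_linear0; congr h.
  by apply/funext => w; rewrite big_nil.
rewrite big_cons -IH -pointwise_linearD; congr h.
by apply/funext => w; rewrite big_cons.
Qed.
End PointwiseLinear.

(** * Multilinear functions on sequences and their differential *)

Section SeqMultilinear.
Variables (k : fieldType) (A : algebra k).

Definition seq_multilinear (W : lmodType k) (F : seq A -> W) :=
  forall s t c x y,
    F (s ++ (c *: x + y) :: t) = c *: F (s ++ x :: t) + F (s ++ y :: t).

Variables (W : lmodType k) (F : seq A -> W).
Hypothesis F_lin : seq_multilinear F.

Lemma seq_multilinear_cons a : seq_multilinear (fun w => F (a :: w)).
Proof. by move=> s t c x y; apply: (F_lin (a :: s)). Qed.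

Lemma seq_multilinear_head t : linear (fun a => F (a :: t)).
Proof. by move=> c x y; apply: (F_lin [::]). Qed.

Lemma seq_multilinear_sum (I : finType) (x : I -> A) t :
  F (\sum_i x i :: t) = \sum_i F (x i :: t).
Proof.
have FD a b : F (a + b :: t) = F (a :: t) + F (b :: t).
  by have := seq_multilinear_head t 1 a b; rewrite !scale1r.
have F0 : F (0 :: t) = 0 by apply: (addrI (F (0 :: t))); rewrite -FD !addr0.
exact: (big_morph (fun a => F (a :: t)) FD F0).
Qed.
End SeqMultilinear.

(** All degrees at once. The value 0 at [[::]] reflects that degree 0 has no nonzero
    coboundaries. *)
Definition seq_d (A : pzRingType) (F : seq A -> A) (s : seq A) : A :=
  if s is a :: s' then a * F s' + face_sum *%R F s else 0.

(** * The recursion shared by the self-transfer of [A] and the transfer into [P] *)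

Section SeqTransfer.
Variables (k : fieldType) (A B : algebra k) (N : lmodType k) (I : finType).
Variables (x : I -> I -> B -> A) (e : I -> A -> N).
Implicit Types (F G : seq A -> A).

(* The summand of the transfer with the leftmost index i fixed, before the left
   factor <q_i, -> is applied. *)
Fixpoint seq_transfer i F (s : seq B) : N :=
  if s is b :: t then \sum_i' seq_transfer i' (fun w => F (x i i' b :: w)) t
  else e i (F [::]).

Lemma seq_transfer_linear (e_lin : forall i, linear (e i)) i c F G s :
  seq_transfer i (fun w => c *: F w + G w) s =
  c *: seq_transfer i F s + seq_transfer i G s.
Proof.
elim: s i F G => [|b t IH] i F G /=; first exact: e_lin.
rewrite scaler_sumr -big_split; apply: eq_bigr => i' _.
exact: (IH i' (fun w => F (_ :: w)) (fun w => G (_ :: w))).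
Qed.
End SeqTransfer.

(** * The self-transfer and its homotopy to the identity *)

Section SelfTransfer.
Variables (k : fieldType) (A : algebra k) (I : finType) (u v : I -> A).
Implicit Types (F G : seq A -> A) (i : I) (s : seq A).

Let x i i' (a : A) : A := u i * a * v i'.

Definition self_transfer : I -> (seq A -> A) -> seq A -> A :=
  seq_transfer (N := A) x (fun i a => a * u i).

(* The recursion produces the signs (-1)^s of the homotopy; the left factor v_i
   is left out. *)
Fixpoint htpy i F s : A :=
  if s is a :: t then
    F (u i :: a :: t) - \sum_i' htpy i' (fun w => F (x i i' a :: w)) t
  else F [:: u i].

Lemma htpy_cons i F a t : htpy i F (a :: t) =
  F (u i :: a :: t) - \sum_i' htpy i' (fun w => F (x i i' a :: w)) t.
Proof. by []. Qed.

Lemma eq_htpy i F G s : (forall w, size w = (size s).+1 -> F w = G w) ->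
  htpy i F s = htpy i G s.
Proof.
elim: s i F G => [|a t IH] i F G FG /=; first exact: FG.
rewrite FG //; congr (_ - _); apply: eq_bigr => i' _.
by apply: IH => w sw; apply: FG; rewrite /= sw.
Qed.

Lemma htpy_linear i c F G s :
  htpy i (fun w => c *: F w + G w) s = c *: htpy i F s + htpy i G s.
Proof.
elim: s i F G => [|a t IH] i F G //=.
rewrite (eq_bigr _ (fun i' _ =>
  IH i' (fun w => F (x i i' a :: w)) (fun w => G (x i i' a :: w)))).
by rewrite big_split -scaler_sumr scalerBr opprD addrACA.
Qed.

(** Makes the term with [seq_d F] vanish when [F] comes from a cocycle. *)
Lemma htpy_eq0 i F s : (forall w, size w = (size s).+1 -> F w = 0) ->
  htpy i F s = 0.
Proof.
move=> F0; rewrite (eq_htpy i F0).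
exact: (pointwise_linear0 (fun c G H => htpy_linear i c G H s)).
Qed.

Lemma htpyM i a F s : htpy i (fun w => a * F w) s = a * htpy i F s.
Proof.
elim: s i F => [|b t IH] i F //=.
rewrite (eq_bigr _ (fun i' _ => IH i' (fun w => F (x i i' b :: w)))).
by rewrite mulrBr mulr_sumr.
Qed.

(** Needed to turn the homotopy into a cochain. *)
Lemma htpy_multilinear i F : seq_multilinear F -> seq_multilinear (htpy i F).
Proof.
move=> F_lin s t c a b; elim: s i F F_lin => [|d s IH] i F F_lin /=.
  have -> := F_lin [:: u i] t c a b.
  (* A varied head entry [a] occurs both bare and inside [u i * a * v i']; [E] treats the second
     place. *)
  have E i' : htpy i' (fun w => F (x i i' (c *: a + b) :: w)) t =
      c *: htpy i' (fun w => F (x i i' a :: w)) t +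
      htpy i' (fun w => F (x i i' b :: w)) t.
    rewrite -htpy_linear; apply: eq_htpy => w _.
    by rewrite /x mulrDr mulrDl -algZr -algZl (seq_multilinear_head F_lin).
  by rewrite (eq_bigr _ (fun i' _ => E i')) big_split -scaler_sumr scalerBr
    opprD addrACA.
have -> := F_lin (u i :: d :: s) t c a b.
rewrite (eq_bigr _ (fun i' _ => IH i' _ (seq_multilinear_cons F_lin (x i i' d)))).
by rewrite big_split -scaler_sumr scalerBr opprD addrACA.
Qed.

Hypothesis vu1 : \sum_i v i * u i = 1.

Lemma sum_uavu i a : \sum_i' x i i' a * u i' = u i * a.
Proof.
by rewrite -[RHS]mulr1 -vu1 mulr_sumr; apply: eq_bigr => i' _; rewrite mulrA.
Qed.

(* Merging the inserted [u i'] with the preceding entry [u i a v i'] telescopes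
   by [sum_i' v i' u i' = 1]. *)
Lemma htpy_merge F i a b t : seq_multilinear F ->
  \sum_i' htpy i' (fun w => if w is y :: w' then F (x i i' a * y :: w') else 0)
    (b :: t) =
  F (u i * a :: b :: t) - F (u i :: a * b :: t) + htpy i F (a * b :: t).
Proof.
move=> F_lin /=; rewrite big_split sumrN /=.
rewrite -seq_multilinear_sum // sum_uavu addrA addrNK; congr (_ - _).
rewrite exchange_big; apply: eq_bigr => j _ /=.
have lin w : \sum_i' F (x i i' a * x i' j b :: w) = F (x i j (a * b) :: w).
  rewrite -seq_multilinear_sum //; congr (F (_ :: w)).
  rewrite [RHS]/x mulrA -(sum_uavu i a) !mulr_suml; apply: eq_bigr => i' _.
  by rewrite [x i' j b]/x !mulrA.
rewrite -(pointwise_linear_sum (fun c G H => htpy_linear j c G H t)).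
by apply: eq_htpy => w _; apply: lin.
Qed.

Let mulB (a : A) : {morph (fun y : A => y * a) : y z / y - z}.
Proof. by move=> y z; rewrite mulrBl. Qed.

(** The faces joining the inserted [u i] to a neighbour cancel between consecutive insertion places,
    and the faces away from it cancel between the two terms. Only the last face with the insertion
    at the end remains, and this is the self-transfer. *)
Lemma htpy_face_sum F i s : seq_multilinear F ->
  htpy i (face_sum *%R F) s + face_sum *%R (htpy i F) s =
  - self_transfer i F s.
Proof.
elim: s i F => [|a s IH] i F F_lin; first by rewrite /= addr0.
case: s IH => [_|b t IH].
  rewrite /self_transfer /= sumrB !sumrN -(sum_uavu i a) seq_multilinear_sum //.
  by rewrite !opprK opprD opprK addrACA addNr add0r addrAC subrr sub0r.
(* [X] and [Y] have [u i] in front and come from merging [u i] with [a], and [a] with [b]; [C]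
   collects the later faces behind [u i] and [a], [K] is the homotopy at [a * b :: t], and [S], [T]
   are the two sums of the induction hypothesis. *)
have cancel (X Y C K S T : A) :
    - X - (- Y - C) - (- (X - Y + K) - S) + (- K - (C - T)) = S + T.
  rewrite !opprD !opprK !addrA [LHS](ACl (1*4*2*5*3*9*6*8*7*10))%AC /=.
  by rewrite addNr add0r subrr add0r subrr add0r subrr add0r.
pose Fx i' w := F (x i i' a :: w).
have Fx_lin i' : seq_multilinear (Fx i') by apply: seq_multilinear_cons.
rewrite htpy_cons.
(* The first face merges [x i i' a] with the next entry. The default 0 is not reached, since [htpy]
   evaluates its function on nonempty sequences only. *)
rewrite (eq_bigr (fun i' =>
  - htpy i' (fun w => if w is y :: w' then F (x i i' a * y :: w') else 0) (b :: t)
  - htpy i' (face_sum *%R (Fx i')) (b :: t))); last first.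
  move=> i' _; have hl c G H := htpy_linear i' c G H (b :: t).
  rewrite -opprD -(pointwise_linearD hl) -(pointwise_linearN hl).
  by apply: eq_htpy => -[|y w] //= _; rewrite opprD.
rewrite sumrB sumrN htpy_merge // !face_sum_cons2.
rewrite (face_sumB mulB (fun w => F (u i :: a :: w))) (face_sum_sum mulB).
have IHs : - \sum_i' self_transfer i' (Fx i') (b :: t) =
    \sum_i' htpy i' (face_sum *%R (Fx i')) (b :: t) +
    \sum_i' face_sum *%R (htpy i' (Fx i')) (b :: t).
  by rewrite -sumrN -big_split; apply: eq_bigr => i' _ /=; rewrite IH.
rewrite [RHS]IHs; exact: cancel.
Qed.

(** The faces other than the left one give the self-transfer by [htpy_face_sum]. For the left face,
    insertion in first place gives the sum of [v i * u i * F s], which is [F s]; the other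
    insertions cancel the left face of the homotopy. *)
Lemma htpy_d F s : seq_multilinear F ->
  seq_d (fun w => \sum_i v i * htpy i F w) s + \sum_i v i * htpy i (seq_d F) s =
  F s - \sum_i v i * self_transfer i F s.
Proof.
move=> F_lin.
have face : \sum_i v i * htpy i (face_sum *%R F) s
    + face_sum *%R (fun w => \sum_i v i * htpy i F w) s =
    - \sum_i v i * self_transfer i F s.
  rewrite (face_sum_sum mulB (fun i w => v i * htpy i F w)) -big_split -sumrN.
  apply: eq_bigr => i _ /=.
  rewrite -mulrN -htpy_face_sum // mulrDr; congr (_ + _).
  by apply: (face_sum_morph (h := *%R (v i))) => [y z|y a];
    rewrite (mulrBr, mulrA).
have left : \sum_i v i * htpy i (fun w => if w is y :: w' then y * F w' else 0) s =
    F s - (if s is a :: t then a * \sum_i v i * htpy i F t else 0).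
  case: (s) => [|a t] /=.
    rewrite subr0 -[RHS]mul1r -vu1 mulr_suml.
    by apply: eq_bigr => i _; rewrite mulrA.
  set K := (X in _ - a * X).
  rewrite -[RHS]mul1r -vu1 mulr_suml; apply: eq_bigr => i _.
  rewrite -mulrA [in RHS]mulrBr; congr (_ * (_ - _)).
  rewrite mulrA mulr_sumr; apply: eq_bigr => i' _.
  by rewrite mulrA -/(x i i' a) htpyM.
have -> : \sum_i v i * htpy i (seq_d F) s =
    \sum_i v i * htpy i (fun w => if w is y :: w' then y * F w' else 0) s +
    \sum_i v i * htpy i (face_sum *%R F) s.
  rewrite -big_split; apply: eq_bigr => i _ /=; rewrite -mulrDr.
  rewrite -(pointwise_linearD (fun c G H => htpy_linear i c G H s)).
  by congr (_ * _); apply: eq_htpy => -[].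
set H := fun w => \sum_i v i * htpy i F w.
have -> : seq_d H s =
    (if s is a :: t then a * H t else 0) + face_sum *%R H s.
  by case: (s) => [|a t] //; rewrite /= addr0.
by rewrite left -face addrACA [X in X + _]addrC subrK [X in _ + X]addrC.
Qed.
End SelfTransfer.

(* [brB] of [M] is convertible to [brA] of [morita_sym M], and [psi] to [phi]:
   lemmas on [brA] and [phi] are applied to the other side in this way. *)
Definition morita_sym (k : fieldType) (A B : algebra k) (M : morita_data A B) :
    morita_data B A :=
  @MoritaData k B A (mQ M) (mP M) (pairB M) (pairA M) (@pairB_assoc _ _ _ M)
    (@pairA_assoc _ _ _ M).

Lemma linear_fun_sum (k : fieldType) (U V : lmodType k) (h : U -> V) :
  linear h -> forall (I : finType) (x : I -> U), h (\sum_i x i) = \sum_i h (x i).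
Proof.
move=> h_lin I x.
have hD y z : h (y + z) = h y + h z by have := h_lin 1 y z; rewrite !scale1r.
have h0 : h 0 = 0 by apply: (addrI (h 0)); rewrite -hD !addr0.
exact: (big_morph h hD h0).
Qed.

Lemma linear_fun0 (k : fieldType) (U V : lmodType k) (h : U -> V) :
  linear h -> h 0 = 0.
Proof. by move=> /linear_fun_sum/(_ 'I_0 (fun=> 0)); rewrite !big_ord0. Qed.

Lemma linear_funB (k : fieldType) (U V : lmodType k) (h : U -> V) :
  linear h -> {morph h : x y / x - y}.
Proof.
by move=> h_lin x y; rewrite -[- y]scaleN1r addrC h_lin scaleN1r addrC.
Qed.

(** * Calculus of the Morita brackets *)

Section Brackets.
Variables (k : fieldType) (A B : algebra k) (M : morita_data A B).
Implicit Types (p : mP M) (q : mQ M).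

Lemma brA_linearr p : linear (fun q => brA p q : A).
Proof. by move=> c q q'; rewrite /brA tens_linearr linearP. Qed.

Lemma brA_lact a p q : brA (lact a p) q = a * brA p q.
Proof. by have := iso_lact (pairA M) a (tens p q); rewrite [lact a _]tensor_lactE. Qed.

Lemma brA_ract p q a : brA p (ract q a) = brA p q * a.
Proof. by have := iso_ract (pairA M) (tens p q) a; rewrite [ract _ a]tensor_ractE. Qed.

Lemma brA_mid p b q : brA (ract p b) q = brA p (lact b q).
Proof. by rewrite /brA tens_mid. Qed.

Lemma brA_assoc p q p' : lact (brA p q) p' = ract p (brB q p').
Proof. exact: pairA_assoc. Qed.
End Brackets.

(** * The transfer on sequences commutes with the differential *)

Section MoritaTransfer.
Variables (k : fieldType) (A B : algebra k) (M : morita_data A B).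
Variables (m : nat) (p : 'I_m -> mP M) (q : 'I_m -> mQ M).
Implicit Types (F : seq A -> A).

Let x i i' (b : B) : A := brA (p i) (lact b (q i')).

(** Stopping before the pairing with [q i] leaves a value in the right [B]-module [P], so that
    [face_sum] can be formed with [i] fixed. *)
Definition module_transfer : 'I_m -> (seq A -> A) -> seq B -> mP M :=
  seq_transfer x (fun i a => lact a (p i)).

Definition morita_transfer F (s : seq B) : B :=
  \sum_i brB (q i) (module_transfer i F s).

Let Msym := morita_sym M.
Let brB_linearr (z : mQ M) : linear (fun y : mP M => brB z y : B).
Proof. exact: (brA_linearr (M := Msym)). Qed.

Lemma module_transfer_cons i F b s : module_transfer i F (b :: s) =
  \sum_i' module_transfer i' (fun w => F (x i i' b :: w)) s.
Proof. by []. Qed.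

Lemma module_transfer_linear i s c F G :
  module_transfer i (fun w => c *: F w + G w) s =
  c *: module_transfer i F s + module_transfer i G s.
Proof. by apply: seq_transfer_linear => j a b d; rewrite lact_linearl. Qed.

Lemma module_transfer_lact i a F s :
  module_transfer i (fun w => a * F w) s = lact a (module_transfer i F s).
Proof.
rewrite /module_transfer; elim: s i F => [|b s IH] i F /=; first by rewrite lactA.
rewrite (linear_fun_sum (lact_linearr a)); apply: eq_bigr => i' _.
exact: (IH i' (fun w => F (_ :: w))).
Qed.

Hypothesis h1B : 1 = \sum_(i < m) brB (q i) (p i).

(** Insert [1_B] between [b] and [b'] and move the bracket by associativity. This handles the inner
    faces; the next two lemmas do the same for the last and the left face. *)
Lemma sum_bracket_mul i i'' b b' : \sum_i' x i i' b * x i' i'' b' = x i i'' (b * b').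
Proof.
rewrite /x -(lactA b b') -[lact b' _ in RHS]lact1 h1B.
rewrite (linear_fun_sum (lact_linearl (lact b' (q i'')))).
rewrite (linear_fun_sum (lact_linearr b)).
rewrite (linear_fun_sum (brA_linearr (p i))); apply: eq_bigr => i' _.
by rewrite (brA_assoc (M := Msym)) -lractA brA_ract.
Qed.

Lemma sum_bracket_lact i b : \sum_i' lact (x i i' b) (p i') = ract (p i) b.
Proof.
rewrite -[b in RHS]mulr1 h1B mulr_sumr (linear_fun_sum (ract_linearr (p i))).
apply: eq_bigr => i' _; rewrite brA_assoc; congr (ract _ _).
exact: (brA_lact (M := Msym)).
Qed.

Lemma sum_brB_lact i' b y :
  \sum_i brB (q i) (lact (x i i' b) y) = b * brB (q i') y.
Proof.
rewrite -[RHS]mul1r h1B mulr_suml; apply: eq_bigr => i _.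
rewrite -[LHS](brA_mid (M := Msym)) -(brA_assoc (M := Msym)).
by rewrite [LHS](brA_lact (M := Msym)); congr (_ * _); apply: (brA_lact (M := Msym)).
Qed.

Lemma module_transfer_face_sum i F s : seq_multilinear F ->
  face_sum (fun y b => ract y b) (module_transfer i F) s =
  module_transfer i (face_sum *%R F) s.
Proof.
have ractB b : {morph (fun y : mP M => ract y b) : y z / y - z}.
  exact: linear_funB (ract_linearl b).
elim: s i F => [|b s IH] i F F_lin.
  by rewrite /= (linear_fun0 (lact_linearl (p i))).
case: s IH => [_|b' t IH].
  rewrite /= lractA -sum_bracket_lact (linear_fun_sum (lact_linearr (F [::]))) -sumrN.
  apply: eq_bigr => i' _; rewrite lactA -[in RHS]sub0r.
  rewrite (linear_funB (lact_linearl (p i'))).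
  by rewrite (linear_fun0 (lact_linearl (p i'))) sub0r.
pose Fx i' w := F (x i i' b :: w).
rewrite face_sum_cons2.
rewrite (face_sum_sum ractB (fun i' => module_transfer i' (Fx i'))).
rewrite (eq_bigr _ (fun i' _ => IH i' (Fx i') (seq_multilinear_cons F_lin _))).
have lin j := pointwise_linear_sum (module_transfer_linear j t).
have linD j := pointwise_linearD (module_transfer_linear j t).
have linN j := pointwise_linearN (module_transfer_linear j t).
have E i' : module_transfer i' (fun w => face_sum *%R F (x i i' b :: w)) (b' :: t)
    = - \sum_j module_transfer j (fun w => F (x i i' b * x i' j b' :: w)) t
      - module_transfer i' (face_sum *%R (Fx i')) (b' :: t).
  rewrite !module_transfer_cons -!sumrN -big_split; apply: eq_bigr => j _ /=.
  by rewrite -!linN -linD.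
rewrite [RHS]module_transfer_cons (eq_bigr _ (fun i' _ => E i')) big_split /= !sumrN.
(* With the sum over [i'] innermost, [sum_bracket_mul] contracts two brackets to one. *)
congr (- _ - _); rewrite exchange_big; apply: eq_bigr => j _ /=.
rewrite -lin; congr module_transfer; apply/funext => w.
by rewrite -seq_multilinear_sum // sum_bracket_mul.
Qed.

Lemma morita_transfer_d F s : seq_multilinear F ->
  seq_d (morita_transfer F) s = morita_transfer (seq_d F) s.
Proof.
move=> F_lin; rewrite /morita_transfer; case: s => [|b s].
  rewrite /= big1 // => i _.
  by rewrite (linear_fun0 (lact_linearl (p i))) (linear_fun0 (brB_linearr (q i))).
rewrite [LHS]/seq_d.
rewrite (face_sum_sum _ (fun i w => brB (q i) (module_transfer i F w))); last first.
  by move=> c y z; rewrite mulrBl.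
(* The left face: [sum_brB_lact] trades the factor [b] for a new leftmost index. *)
have -> : b * (\sum_i brB (q i) (module_transfer i F s)) =
  \sum_i brB (q i) (\sum_i' lact (x i i' b) (module_transfer i' F s)).
  rewrite (eq_bigr _ (fun i _ => linear_fun_sum (brB_linearr (q i)) _)) exchange_big.
  by rewrite mulr_sumr; apply: eq_bigr => i' _ /=; rewrite sum_brB_lact.
have E i : brB (q i) (module_transfer i (seq_d F) (b :: s)) =
    brB (q i) (\sum_i' lact (x i i' b) (module_transfer i' F s)) +
    face_sum *%R (fun w => brB (q i) (module_transfer i F w)) (b :: s).
  rewrite (face_sum_morph (act := fun y b => ract y b)); first last.
  - by move=> y c; apply: (brA_ract (M := Msym)).
  - exact: linear_funB (brB_linearr (q i)).
  rewrite module_transfer_face_sum // !module_transfer_cons.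
  have brD y z : brB (q i) (y + z) = brB (q i) y + brB (q i) z.
    by have := brB_linearr (q i) 1 y z; rewrite !scale1r.
  rewrite -brD -big_split; congr brB; apply: eq_bigr => i' _ /=.
  rewrite -module_transfer_lact.
  by rewrite -(pointwise_linearD (module_transfer_linear i' s)).
by rewrite (eq_bigr _ (fun i _ => E i)) big_split.
Qed.
End MoritaTransfer.

Lemma sum_pair (V : nmodType) (I J : finType) (F : I * J -> V) :
  \sum_ij F ij = \sum_j \sum_i F (i, j).
Proof. by rewrite exchange_big pair_bigA; apply: eq_bigr => -[]. Qed.

(** * The composite of the two transfers as a self-transfer *)

Section TransferComposition.
Variables (k : fieldType) (A B : algebra k) (M : morita_data A B).
Variables (m : nat) (p : 'I_m -> mP M) (q : 'I_m -> mQ M).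
Variables (m' : nat) (p' : 'I_m' -> mP M) (q' : 'I_m' -> mQ M).

Let Msym := morita_sym M.

Definition comp_left (ij : 'I_m * 'I_m') : A := brA (p ij.1) (q' ij.2).
Definition comp_right (ij : 'I_m * 'I_m') : A := brA (p' ij.2) (q ij.1).

(** A nested bracket splits as [<p_i, <q'_j, a p'_j'> q_i'> = <p_i, q'_j> a <p'_j', q_i'>], which
    has the form [u a v]. *)
Lemma module_transfer_comp (y : mQ M) F i j s :
  module_transfer (M := Msym) q' p' j
    (fun w => brB y (module_transfer p q i F w)) s =
  ract y (self_transfer comp_left comp_right (i, j) F s).
Proof.
elim: s i j F => [|a s IH] i j F.
  by rewrite /= (brA_assoc (M := Msym)) [brB _ _]brA_lact.
rewrite module_transfer_cons /self_transfer /= (linear_fun_sum (ract_linearr y)).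
rewrite sum_pair; apply: eq_bigr => j' _.
rewrite (eq_bigr _ (fun i' _ => esym (IH i' j' _))).
rewrite -(pointwise_linear_sum (module_transfer_linear (M := Msym) q' p' j' s)).
congr (module_transfer (M := Msym)); apply/funext => w.
rewrite (linear_fun_sum (brA_linearr (M := Msym) y : linear (brB y))).
apply: eq_bigr => i' _; congr (brB y (module_transfer _ _ _ _ _)).
apply/funext => t; congr (F (_ :: t)).
by rewrite (brA_assoc (M := Msym)) brA_ract [brB _ _]brA_lact mulrA.
Qed.

Lemma morita_transfer_comp F s :
  morita_transfer (M := Msym) q' p' (morita_transfer p q F) s =
  \sum_ij comp_right ij * self_transfer comp_left comp_right ij F s.
Proof.
rewrite sum_pair; apply: eq_bigr => j _ /=.
rewrite (pointwise_linear_sum (module_transfer_linear (M := Msym) q' p' j s)).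
rewrite (linear_fun_sum (brA_linearr (p' j) : linear (brB (M := Msym) (p' j)))).
by apply: eq_bigr => i _; rewrite module_transfer_comp [LHS]brA_ract.
Qed.

Hypothesis h1B : 1 = \sum_(i < m) brB (q i) (p i).
Hypothesis h1A : 1 = \sum_(j < m') brA (p' j) (q' j).

(** Insert [1_B] in each bracket [<p'_j, q'_j>]. *)
Lemma comp_right_left : \sum_ij comp_right ij * comp_left ij = 1.
Proof.
rewrite h1A sum_pair; apply: eq_bigr => j _; rewrite -[q' j in RHS]lact1 h1B.
rewrite (linear_fun_sum (lact_linearl (q' j))).
rewrite (linear_fun_sum (brA_linearr (p' j))); apply: eq_bigr => i _.
by rewrite (brA_assoc (M := Msym)) brA_ract.
Qed.
End TransferComposition.

(** * Representing cochains by functions on sequences *)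

Section SequenceCochains.
Variables (k : fieldType) (A : algebra k).

Lemma codom_ordS (T : Type) n (a : 'I_n.+1 -> T) :
  codom a = a ord0 :: codom (fun i => a (lift ord0 i)).
Proof. by rewrite /codom /image_mem enum_ordSl /= -map_comp. Qed.

Lemma codom_ord0 (T : Type) (a : 'I_0 -> T) : codom a = [::].
Proof. by apply/size0nil; rewrite size_codom card_ord. Qed.

Lemma codom_nth (T : Type) (x0 : T) s :
  codom (fun i : 'I_(size s) => nth x0 s i) = s.
Proof.
by elim: s => [|x s IH]; rewrite ?codom_ord0 // codom_ordS; congr (_ :: _).
Qed.

(** The summand [j = 0] merges the first two entries; the others are faces of [tail a] shifted by
    one position, whence the signs. *)
Lemma face_sum_codom n (F : seq A -> A) (a : 'I_n.+1 -> A) :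
  face_sum *%R F (codom a) =
    \sum_(j < n) (-1) ^+ j.+1 *: F (codom (contract j a))
    + (-1) ^+ n.+1 *: (F (codom (front a)) * a ord_max).
Proof.
elim: n F a => [|n IH] F a.
  rewrite codom_ordS !codom_ord0 big_ord0 add0r expr1 scaleN1r /=.
  by congr (- (_ * a _)); apply: val_inj.
have -> : codom a = a ord0 :: tail a ord0 :: codom (tail (tail a)).
  by rewrite codom_ordS [X in _ :: X]codom_ordS.
rewrite face_sum_cons2 -[tail a ord0 :: _](codom_ordS (tail a)) IH.
have front0 : front a ord0 = a ord0 by congr (a _); apply: val_inj.
rewrite big_ord_recl expr1 scaleN1r opprD -!addrA; congr (_ + _).
  congr (- F _); rewrite [RHS]codom_ordS -front0; congr (_ :: codom _).
rewrite -sumrN; congr (_ + _).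
  apply: eq_bigr => j _; rewrite [in RHS]exprS mulN1r scaleNr; congr (- (_ *: F _)).
  rewrite [RHS]codom_ordS -front0; congr (_ :: codom _).
  apply/funext => i.
  have frontE : front (tail a) i = front a (lift ord0 i) by congr (a _); apply: val_inj.
  by rewrite /contract /tail !lift0 ltnS (inj_eq lift_inj) -frontE.
rewrite [in RHS]exprS mulN1r scaleNr; congr (- (_ *: (F _ * a _))).
  rewrite [RHS]codom_ordS front0; congr (_ :: codom _).
  by apply/funext => i; congr (a _); apply: val_inj.
by apply: val_inj.
Qed.

(** Constrains [F] in length [n] only. *)
Definition represents n (f : cochain A n) (F : seq A -> A) :=
  forall a, f (ptens a) = F (codom a).

Lemma represents_d n (f : cochain A n) F : represents f F ->
  represents (hoch_d A n f) (seq_d F).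
Proof.
move=> fF a; rewrite [LHS]hoch_dE /hoch_fun codom_ordS /seq_d -codom_ordS.
rewrite face_sum_codom addrA !fF; congr (_ + _ + _).
by apply: eq_bigr => j _; rewrite fF.
Qed.

(** Extension by 0 keeps multilinearity in all lengths; the default of [nth] is not reached in
    length [n]. *)
Definition seq_of_cochain n (f : cochain A n) (s : seq A) : A :=
  if size s == n then f (ptens (fun i : 'I_n => nth 0 s i)) else 0.

Lemma represents_seq n (f : cochain A n) : represents f (seq_of_cochain f).
Proof.
move=> a; rewrite /seq_of_cochain size_codom card_ord eqxx; congr (f (ptens _)).
apply/funext => i; rewrite /codom /image_mem (nth_map i) ?size_enum_ord //.
by rewrite nth_ord_enum.
Qed.

Lemma seq_of_cochain_multilinear n (f : cochain A n) :
  seq_multilinear (seq_of_cochain f).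
Proof.
move=> s t c x y; rewrite /seq_of_cochain !size_cat /=.
case: eqP => [def_n|_]; last by rewrite scaler0 addr0.
have lt_n : (size s < n)%N by rewrite -def_n addnS ltnS leq_addr.
rewrite -linearP; congr (f _).
apply: (ptens_multilinear (i := Ordinal lt_n)).
split=> [|j]; rewrite /= !nth_cat ?ltnn ?subnn //.
rewrite -val_eqE /= => js.
case: ltngtP js => // sj _; rewrite -subnSK //.
Qed.

Lemma multilinear_codom n (F : seq A -> A) : seq_multilinear F ->
  multilinear (fun a : 'I_n -> A => F (codom a)).
Proof.
elim: n F => [|n IH] F F_lin i c x y z xyz; first by case: i xyz.
rewrite !codom_ordS.
have [i0|[i' def_i]] : i = ord0 \/ exists i', i = lift ord0 i'.
- by case: (unliftP ord0 i) => [i'|] ->; [right; exists i' | left].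
- have [zx zy] := tail_fixed xyz i0.
  rewrite -/(tail x) -/(tail y) -/(tail z) -zx -zy -i0 xyz.1.
  exact: (seq_multilinear_head F_lin).
- have [|<- <-] := xyz.2 ord0; first by rewrite def_i neq_lift.
  exact: (IH _ (seq_multilinear_cons F_lin _) _ _ _ _ _ (tail_splits xyz def_i)).
Qed.

Lemma represents_inj n (f g : cochain A n) F G : represents f F ->
  represents g G -> (forall s, size s = n -> F s = G s) -> f = g.
Proof.
move=> fF gG FG; apply: tpow_ext => a; rewrite fF gG FG //.
by rewrite size_codom card_ord.
Qed.
Lemma represents0 n F s : represents (0 : cochain A n) F -> size s = n -> F s = 0.
Proof.
move=> repF def_n; case: n / def_n F repF => F repF.
by rewrite -[s in LHS](codom_nth 0) -repF.
Qed.
End SequenceCochains.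

(** Splits off the leftmost index, as the recursion of [seq_transfer] does. *)
Lemma sum_ffunS (V : nmodType) m n (F : {ffun 'I_n.+1 -> 'I_m} -> V) :
  \sum_i F i = \sum_i0 \sum_(i : {ffun 'I_n -> 'I_m})
    F [ffun l => if unlift ord0 l is Some l' then i l' else i0].
Proof.
rewrite pair_bigA /=.
pose cons (x : 'I_m * {ffun 'I_n -> 'I_m}) : {ffun 'I_n.+1 -> 'I_m} :=
  [ffun l => if unlift ord0 l is Some l' then x.2 l' else x.1].
rewrite (reindex cons) //.
exists (fun i : {ffun 'I_n.+1 -> 'I_m} => (i ord0, [ffun l => i (lift ord0 l)])) => i _.
  by rewrite /cons; case: i => i0 i; congr pair; rewrite ?ffunE ?unlift_none //;
    apply/ffunP => l; rewrite !ffunE liftK.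
by apply/ffunP => l; rewrite ffunE /=; case: unliftP => [l'|] -> //; rewrite ffunE.
Qed.

(** * The recursive transfer agrees with the sum over index tuples *)

Section PhiRepresents.
Variables (k : fieldType) (A B : algebra k) (M : morita_data A B).
Variables (m : nat) (p : 'I_m -> mP M) (q : 'I_m -> mQ M).

(** The dependence of [F] and [h] on the leftmost index serves the induction: after one step [F] has
    absorbed the first bracket, which involves the new index, while [h] is constantly [h i0]. *)
Lemma module_transfer_codom (V : nmodType) n (F : 'I_m -> seq A -> A) (b : 'I_n -> B)
    (h : 'I_m -> mP M -> V) :
  (forall i, {morph h i : y z / y + z}) -> (forall i, h i 0 = 0) ->
  \sum_i h i (module_transfer p q i (F i) (codom b)) =
  \sum_(i : {ffun 'I_n.+1 -> 'I_m})
    h (i ord0) (lact (F (i ord0) (codom (transfer_arg (pairA M) p q i b)))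
      (p (i ord_max))).
Proof.
move=> hD h0; elim: n F b h hD h0 => [|n IH] F b h hD h0.
  rewrite -(sum_ffun1 (fun i => h i (module_transfer p q i (F i) (codom b)))).
  by apply: eq_bigr => i _; rewrite !codom_ord0 (ord1 ord_max).
rewrite [RHS]sum_ffunS codom_ordS; apply: eq_bigr => i0 _.
rewrite module_transfer_cons (big_morph (h i0) (hD i0) (h0 i0)).
rewrite (IH (fun i w => F i0 (brA (p i0) (lact (b ord0) (q i)) :: w)) _ (fun=> h i0)) //.
apply: eq_bigr => i _.
pose c : {ffun 'I_n.+2 -> 'I_m} :=
  [ffun l => if unlift ord0 l is Some l' then i l' else i0].
have c0 : c ord0 = i0 by rewrite ffunE unlift_none.
have cS l : c (lift ord0 l) = i l by rewrite ffunE liftK.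
have cmax : c ord_max = i ord_max by rewrite -cS; congr (c _); apply: val_inj.
have cW l : c (widen_ord (leqnSn n.+1) (lift ord0 l)) = i (widen_ord (leqnSn n) l).
  by rewrite -cS; congr (c _); apply: val_inj.
have arg0 : transfer_arg (pairA M) p q c b ord0 =
    brA (p i0) (lact (b ord0) (q (i ord0))).
  rewrite /transfer_arg cS (_ : widen_ord _ _ = ord0) ?c0 //.
  exact: val_inj.
have argS : (fun l => transfer_arg (pairA M) p q c b (lift ord0 l)) =
    transfer_arg (pairA M) p q i (fun l => b (lift ord0 l)).
  by apply/funext => l; rewrite /transfer_arg cS cW.
by rewrite -/c c0 cmax [in RHS]codom_ordS arg0 argS.
Qed.

Lemma represents_phi n (f : cochain A n) F : represents f F ->
  represents (phi p q f) (morita_transfer p q F).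
Proof.
move=> fF b; rewrite phiE.
have brB_lin i : linear (brB (q i) : mP M -> B).
  exact: (brA_linearr (M := morita_sym M)).
rewrite [RHS](module_transfer_codom (fun=> F) b (h := fun i => brB (q i) : _ -> B)).
- by apply: eq_bigr => i _; rewrite fF.
- by move=> i y z; have := brB_lin i 1 y z; rewrite !scale1r.
- by move=> i; rewrite (linear_fun0 (brB_lin i)).
Qed.

End PhiRepresents.

(** * The transfer maps on cocycles and coboundaries *)

Lemma phi_linear (k : fieldType) (A B : algebra k) (M : morita_data A B) m
    (p : 'I_m -> mP M) (q : 'I_m -> mQ M) n :
  linear (phi p q (n := n)).
Proof.
move=> c f g; apply: tpow_ext => b /=; rewrite !phiE scaler_sumr -big_split.
apply: eq_bigr => i _ /=; rewrite lact_linearl.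
exact: (brA_linearr (M := morita_sym M)).
Qed.

Lemma phi_d (k : fieldType) (A B : algebra k) (M : morita_data A B) m
    (p : 'I_m -> mP M) (q : 'I_m -> mQ M) n (f : cochain A n) :
  1 = \sum_(i < m) brB (q i) (p i) ->
  hoch_d B n (phi p q f) = phi p q (hoch_d A n f).
Proof.
move=> h1B; have fF := represents_seq f.
apply: (represents_inj (represents_d (represents_phi p q fF))
  (represents_phi p q (represents_d fF))) => s _.
by apply: morita_transfer_d => //; apply: seq_of_cochain_multilinear.
Qed.

Lemma phi_comp_coboundary (k : fieldType) (A B : algebra k) (M : morita_data A B)
    m (p : 'I_m -> mP M) (q : 'I_m -> mQ M)
    m' (p' : 'I_m' -> mP M) (q' : 'I_m' -> mQ M) n (f : cochain A n) :
  1 = \sum_(i < m) brB (q i) (p i) -> 1 = \sum_(j < m') brA (p' j) (q' j) ->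
  hoch_d A n f = 0 -> coboundary (f - psi p' q' (phi p q f)).
Proof.
move=> h1B h1A df0.
have fF := represents_seq f; have F_lin := seq_of_cochain_multilinear f.
set F := seq_of_cochain f in fF F_lin.
have rep := represents_phi (M := morita_sym M) q' p' (represents_phi p q fF).
pose u := comp_left p q'; pose v := comp_right q p'.
pose H s := \sum_ij v ij * htpy u v ij F s.
have dHE s : size s = n -> seq_d H s =
    F s - morita_transfer (M := morita_sym M) q' p' (morita_transfer p q F) s.
  move=> def_n; rewrite morita_transfer_comp.
  (* [seq_d F] represents the differential of [f], which is 0, so it vanishes in length [n + 1], the
     only length that [htpy] at [s] evaluates. *)
  rewrite -(htpy_d (comp_right_left h1B h1A)) // [X in _ + X]big1 ?addr0 // => ij _.
  rewrite htpy_eq0 ?mulr0 // => w; rewrite def_n; apply: represents0.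
  by rewrite -df0; apply: represents_d.
have repB : represents (f - psi p' q' (phi p q f)) (fun s => F s -
    morita_transfer (M := morita_sym M) q' p' (morita_transfer p q F) s).
  by move=> a /=; rewrite fF -rep.
(* In degree 0 the difference itself must vanish, which is [dHE] at [[::]]. *)
case: n f {df0 fF F_lin rep} @F @H dHE repB => [|n] f F H dHE repB.
  apply: (represents_inj repB (G := fun=> 0)) => // -[] // _.
  by rewrite -dHE.
have H_lin : seq_multilinear H.
  move=> s t c x y; rewrite /H scaler_sumr -big_split; apply: eq_bigr => ij _ /=.
  rewrite (htpy_multilinear u v ij (seq_of_cochain_multilinear f)) mulrDr.
  by rewrite algZr.
(* The primitive is [H] on sequences of length [n], one below the degree of [f]. *)
exists (tpow_lift (multilinear_codom (n := n) H_lin)).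
apply: (represents_inj repB (represents_d (F := H) _)) => [a|s /dHE -> //].
exact: tpow_liftE.
Qed.

Lemma phi_coboundary (k : fieldType) (A B : algebra k) (M : morita_data A B) m
    (p : 'I_m -> mP M) (q : 'I_m -> mQ M) n (f : cochain A n) :
  1 = \sum_(i < m) brB (q i) (p i) -> coboundary f -> coboundary (phi p q f).
Proof.
move=> h1B; case: n f => [|n] f /= => [->|[g ->]].
  exact: (linear_fun0 (phi_linear p q (n := 0))).
by exists (phi p q g); rewrite phi_d.
Qed.

(** * Classes and induced maps in Hochschild cohomology *)

Section HHClass.
Variables (k : fieldType) (A : algebra k) (n : nat).

Lemma cocycleP (z : cocycle A n) : hoch_d A n (kernel_val z) = 0.
Proof. by case: z => f f0; apply/eqP. Qed.

Lemma eq_HH_class (f g : cochain A n) (df0 : hoch_d A n f = 0)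
    (dg0 : hoch_d A n g = 0) :
  coboundary (f - g) -> HH_class df0 = HH_class dg0.
Proof.
move=> fg; apply/quot_classP; rewrite -[_ - _]scale1r -[_ *: _]addr0.
by apply: Defs.span_cons (Defs.span_zero _).
Qed.

Lemma HH_classW (Q : HH A n -> Prop) :
  (forall f (df0 : hoch_d A n f = 0), Q (HH_class df0)) -> forall x, Q x.
Proof.
move=> Q_class; elim/quot_classW => z.
by rewrite (_ : z = to_kernel (cocycleP z)); [apply: Q_class | apply: val_inj].
Qed.
End HHClass.

Section HHMap.
Variables (k : fieldType) (A B : algebra k) (n : nat).
Variables (t : cochain A n -> cochain B n).
Hypothesis t_lin : linear t.
Hypothesis t_cocycle : forall f, hoch_d A n f = 0 -> hoch_d B n (t f) = 0.
Hypothesis t_coboundary : forall f, coboundary f -> coboundary (t f).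

Definition cocycle_map (z : cocycle A n) : HH B n :=
  HH_class (t_cocycle (cocycleP z)).

Fact cocycle_map_linear : linear cocycle_map.
Proof.
move=> c y z; rewrite /cocycle_map /HH_class -linearP; congr quot_class.
by apply: val_inj; apply: t_lin.
Qed.
HB.instance Definition _ := GRing.isLinear.Build k (cocycle A n) (HH B n) *:%R
  cocycle_map cocycle_map_linear.

Fact cocycle_map_coboundary z : coboundary (kernel_val z) -> cocycle_map z = 0.
Proof.
move=> bz; have d0 : hoch_d B n 0 = 0 by rewrite linear0.
rewrite -[RHS](linear0 (quot_class _)) (_ : 0 = to_kernel d0); last exact: val_inj.
by apply: eq_HH_class; rewrite subr0; apply: t_coboundary.
Qed.

Definition HH_map : {linear HH A n -> HH B n} := quot_lift cocycle_map_coboundary.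

Lemma HH_mapE f (df0 : hoch_d A n f = 0) :
  HH_map (HH_class df0) = HH_class (t_cocycle df0).
Proof.
rewrite [LHS]quot_liftE; congr quot_class; exact: val_inj.
Qed.
End HHMap.

Theorem theorem2p3 (k : fieldType) (A B : algebra k) (M : morita_data A B)
  (m : nat) (p : 'I_m -> mP M) (q : 'I_m -> mQ M)
  (m' : nat) (p' : 'I_m' -> mP M) (q' : 'I_m' -> mQ M)
  (h1B : 1 = \sum_(i < m) brB (q i) (p i))
  (h1A : 1 = \sum_(j < m') brA (p' j) (q' j))
  (n : nat) :
  exists (dphi : forall f : cochain A n,
                   hoch_d A n f = 0 -> hoch_d B n (phi p q f) = 0)
         (dpsi : forall g : cochain B n,
                   hoch_d B n g = 0 -> hoch_d A n (psi p' q' g) = 0)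
         (Phi : {linear HH A n -> HH B n})
         (Psi : {linear HH B n -> HH A n}),
    [/\ forall (f : cochain A n) (df : hoch_d A n f = 0),
          Phi (HH_class df) = HH_class (dphi f df),
        forall (g : cochain B n) (dg : hoch_d B n g = 0),
          Psi (HH_class dg) = HH_class (dpsi g dg),
        cancel Phi Psi
      & cancel Psi Phi].
Proof.
pose Msym := morita_sym M.
have dphi f : hoch_d A n f = 0 -> hoch_d B n (phi p q f) = 0.
  by move=> df0; rewrite phi_d // df0 (linear_fun0 (phi_linear p q (n := n.+1))).
have dpsi g : hoch_d B n g = 0 -> hoch_d A n (psi p' q' g) = 0.
  (* Over [Msym] the two families change places, so [psi p' q'] is the [phi] of [q'] and [p']. *)
  move=> dg0; rewrite [LHS](phi_d (M := Msym) (p := q') (q := p')) // dg0.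
  exact: (linear_fun0 (phi_linear (M := Msym) q' p' (n := n.+1))).
exists dphi, dpsi.
exists (HH_map (phi_linear p q (n := n)) dphi
  (fun f => phi_coboundary (f := f) h1B)).
exists (HH_map (phi_linear (M := Msym) q' p' (n := n)) dpsi
  (fun g => phi_coboundary (M := Msym) (f := g) h1A)).
split=> [f df0|g dg0||].
- exact: HH_mapE.
- exact: HH_mapE.
- elim/HH_classW => f df0; rewrite !HH_mapE; apply/esym/eq_HH_class.
  exact: phi_comp_coboundary.
- elim/HH_classW => g dg0; rewrite !HH_mapE; apply/esym/eq_HH_class.
  exact: (phi_comp_coboundary (M := Msym) (p := q') (q := p') (p' := q) (q' := p)).
Qed.
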